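(* Let $\Sigma_{\mathbf A}$ be an aperiodic and irreducible subshift of finite type with left shift $\sigma$. Let $\phi\colon\Sigma_{\mathbf A}\to\mathbb{R}$ be a continuous potential, and let $(s_n)_{n\ge0}$ be a monotone decreasing sequence of positive reals such that $\lim_{n\to\infty}s_n=0$ and $\lim_{n\to\infty}S_n=\infty$, where $S_n:=\sum_{k=0}^{n-1}s_k$. Then for every $\alpha\in\mathbb{R}$, $$h_{\rm top}(E_\phi(\alpha))=h_{\rm top}(E_\phi^s(\alpha)).$$
   Context: Let $\mathcal A=\{1,\dots,K\}$ be a finite alphabet, $\Sigma=\mathcal A^{\mathbb N}$ with $\mathbb N=\{0,1,2,\dots\}$, $\sigma$ the left shift, and $d(\mathbf i,\mathbf j)=e^{-\min\{n\ge0:\,i_n\ne j_n\}}$ the metric on $\Sigma$. For a $K\times K$ matrix $\mathbf A$ with entries in $\{0,1\}$, the subshift of finite type is $\Sigma_{\mathbf A}=\{\mathbf i=(i_0,i_1,\dots)\in\Sigma:\mathbf A_{i_k,i_{k+1}}=1\ \text{for all }k\ge0\}$. It is aperiodic and irreducible if there is $r\ge1$ such that every entry of $\mathbf A^r$ is strictly positive. For $\alpha\in\mathbb{R}$, $$E_\phi(\alpha)=\Big\{\mathbf i\in\Sigma_{\mathbf A}:\lim_{n\to\infty}\frac1n\sum_{k=0}^{n-1}\phi(\sigma^k\mathbf i)=\alpha\Big\},\qquad E_\phi^s(\alpha)=\Big\{\mathbf i\in\Sigma_{\mathbf A}:\lim_{n\to\infty}\frac1{S_n}\sum_{k=0}^{n-1}s_k\phi(\sigma^k\mathbf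 i)=\alpha\Big\}.$$ $h_{\rm top}(E)$ is the (Bowen) topological entropy of a not necessarily compact or invariant subset $E\subseteq\Sigma_{\mathbf A}$ with respect to $\sigma$; on $(\Sigma,d)$ it coincides with the Hausdorff dimension with respect to $d$, with $h_{\rm top}(\emptyset)=0$. *)

(* Defs.v *)
From HB Require Import structures.
From mathcomp Require Import all_boot all_order all_algebra.
From mathcomp Require Import all_classical all_reals all_analysis.
Set Implicit Arguments.
Unset Strict Implicit.
Unset Printing Implicit Defensive.
Import Order.TTheory GRing.Theory Num.Theory.
Import numFieldNormedType.Exports.
Local Open Scope classical_set_scope.
Local Open Scope ring_scope.

(* The alphabet {1, ..., K} is 'I_K, i.e. the symbols are numbered from 0.
   The parameter R only fixes the type in which distances take their values. *)
Definition shift_space (R : realType) (K : nat) : Type := nat -> 'I_K.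

HB.instance Definition _ (R : realType) (K : nat) :=
  gen_eqMixin (shift_space R K).
HB.instance Definition _ (R : realType) (K : nat) :=
  gen_choiceMixin (shift_space R K).

Definition shift_dist (R : realType) (K : nat) (i j : shift_space R K) : R :=
  match pselect (exists n, i n != j n) with
  | left h => expR (- (ex_minn h)%:R)
  | right _ => 0
  end.

Section shift_dist_metric.
Context (R : realType) (K : nat).
Implicit Types i j k : shift_space R K.

Lemma shift_distxx i : shift_dist i i = 0.
Proof.
by rewrite /shift_dist; case: pselect => // h; exfalso; case: h => n /eqP.
Qed.

Lemma shift_dist_positivity i j : shift_dist i j = 0 -> i = j.
Proof.
rewrite /shift_dist; case: pselect => [h /eqP|h _]; first by rewrite expR_eq0.
by apply/funext => n; apply: contrapT => /eqP ij; apply: h; exists n.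
Qed.

Lemma shift_dist_sym i j : shift_dist i j = shift_dist j i.
Proof.
rewrite /shift_dist; case: pselect => [h|h]; case: pselect => [g|g] //.
- case: ex_minnP => m mP mmin; case: ex_minnP => l lP lmin.
  suff -> : m = l by [].
  by apply/eqP; rewrite eqn_leq mmin 1?lmin// eq_sym.
- by exfalso; apply: g; case: h => n; exists n; rewrite eq_sym.
- by exfalso; apply: h; case: g => n; exists n; rewrite eq_sym.
Qed.

Lemma shift_dist_ge0 i j : 0 <= shift_dist i j.
Proof. by rewrite /shift_dist; case: pselect => // h; exact: expR_ge0. Qed.

Lemma shift_dist_le i j n :
  (forall m, (m < n)%N -> i m = j m) <-> shift_dist i j <= expR (- n%:R).
Proof.
rewrite /shift_dist; case: pselect => [h|h]; last first.
  split=> [_|_ m _]; first exact: expR_ge0.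
  by apply: contrapT => /eqP ij; apply: h; exists m.
case: ex_minnP => l lP lmin; rewrite ler_expR lerN2 ler_nat; split.
  by move=> eqij; rewrite leqNgt; apply/negP => /eqij/eqP; apply/negP.
move=> nl m mn; apply: contrapT => /eqP/lmin lm.
by have := leq_trans mn (leq_trans nl lm); rewrite ltnn.
Qed.

Lemma shift_dist_triangle j i k :
  shift_dist i k <= shift_dist i j + shift_dist j k.
Proof.
rewrite {1}/shift_dist; case: pselect => [h|h]; last first.
  by rewrite addr_ge0 ?shift_dist_ge0.
case: ex_minnP => n ikn _.
have [ijn|ijn] := eqVneq (i n) (j n).
  apply: (@le_trans _ _ (shift_dist j k)); last first.
    by rewrite lerDr shift_dist_ge0.
  rewrite /shift_dist; case: pselect => [g|[]]; last by exists n; rewrite -ijn.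
  case: ex_minnP => l _ /(_ n); rewrite -ijn => /(_ ikn) ln.
  by rewrite ler_expR lerN2 ler_nat.
apply: (@le_trans _ _ (shift_dist i j)); last by rewrite lerDl shift_dist_ge0.
rewrite /shift_dist; case: pselect => [g|[]]; last by exists n.
by case: ex_minnP => l _ /(_ _ ijn) ln; rewrite ler_expR lerN2 ler_nat.
Qed.

HB.instance Definition _ := isMetric.Build R (shift_space R K)
  shift_distxx shift_dist_positivity shift_dist_sym shift_dist_triangle.

End shift_dist_metric.

Definition left_shift (R : realType) (K : nat) (i : shift_space R K) :
  shift_space R K := fun n => i n.+1.

Definition subshift (R : realType) (K : nat) (A : 'M[nat]_K) :
  set (shift_space R K) := [set i | forall k, A (i k) (i k.+1) = 1%N].

Definition zero_one_mx (K : nat) (A : 'M[nat]_K) : Prop :=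
  forall a b, A a b = 0%N \/ A a b = 1%N.

Definition aperiodic_irreducible (K : nat) (A : 'M[nat]_K) : Prop :=
  exists r : nat, (1 <= r)%N /\ forall a b, (0 < (A ^+ r) a b)%N.

(* Topological entropy of an arbitrary subset, after R. Bowen, "Topological
   entropy for noncompact sets", Trans. AMS 184 (1973). *)
Section bowen_entropy.
Context (R : realType) (X : topologicalType) (T : X -> X).
Local Open Scope ereal_scope.

Definition finite_open_cover (U : set (set X)) : Prop :=
  [/\ finite_set U, (forall V, U V -> open V) &
      \bigcup_(V in U) V = [set: X]].

(* The largest n such that T^k(E) is contained in some member of U for all
   k < n: it is 0 if E is in no member of U, and +oo if there is no largest. *)
Definition cover_time (U : set (set X)) (E : set X) : \bar R :=
  ereal_sup [set n%:R%:E | n in [set n : nat |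
    forall k, (k < n)%N -> exists2 V, U V & iter k T @` E `<=` V]].

Definition cover_diam (U : set (set X)) (E : set X) : \bar R :=
  expeR (- cover_time U E).

(* The empty set has cover_diam 0 and hence weight 0 when lambda > 0, so that
   sequences of sets also account for finite coverings of Y. *)
Definition bowen_premeasure (U : set (set X)) (lambda : R) (Y : set X)
    (eps : R) : \bar R :=
  ereal_inf [set \sum_(0 <= n <oo) poweR (cover_diam U (E n)) lambda |
    E in [set E : nat -> set X |
      Y `<=` \bigcup_n E n /\ forall n, cover_diam U (E n) < eps%:E]].

Definition bowen_measure (U : set (set X)) (lambda : R) (Y : set X) : \bar R :=
  lim (bowen_premeasure U lambda Y eps @[eps --> 0%R^'+]).

Definition bowen_cover_entropy (U : set (set X)) (Y : set X) : \bar R :=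
  ereal_inf [set lambda%:E | lambda in [set lambda : R |
    (0 < lambda)%R /\ bowen_measure U lambda Y = 0]].

Definition bowen_entropy (Y : set X) : \bar R :=
  ereal_sup [set bowen_cover_entropy U Y | U in finite_open_cover].

End bowen_entropy.

(* Entropy of subsets of a subshift is computed in the full shift, which gives
   the same value as the restricted system since the subshift is closed and
   invariant. *)
Definition htop (R : realType) (K : nat) (E : set (shift_space R K)) : \bar R :=
  bowen_entropy R (@left_shift R K) E.

Section birkhoff_level_sets.
Context (R : realType) (K : nat) (A : 'M[nat]_K).
Variable phi : shift_space R K -> R.

Definition birkhoff_level (alpha : R) : set (shift_space R K) :=
  [set i | subshift A i /\
    (n%:R^-1 * \sum_(0 <= k < n) phi (iter k (@left_shift R K) i))
      @[n --> \oo] --> alpha].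

Definition weighted_birkhoff_level (s : nat -> R) (alpha : R) :
  set (shift_space R K) :=
  [set i | subshift A i /\
    ((\sum_(0 <= k < n) s k)^-1 *
       \sum_(0 <= k < n) s k * phi (iter k (@left_shift R K) i))
      @[n --> \oo] --> alpha].

End birkhoff_level_sets.

(* Main.v *)
Require Import Defs.
From HB Require Import structures.
From mathcomp Require Import all_boot all_order all_algebra.
From mathcomp Require Import all_classical all_reals all_analysis.
From mathcomp Require Import ring lra zify.
Set Implicit Arguments.
Unset Strict Implicit.
Unset Printing Implicit Defensive.
Import Order.TTheory GRing.Theory Num.Theory.
Import numFieldNormedType.Exports.
Local Open Scope classical_set_scope.
Local Open Scope ring_scope.

(** Put g = phi - alpha and let G_n(x) be the n-th Birkhoff sum of g at x.
    The two level sets are caught between two extreme sets of the subshift: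
    - the points with G_n(x) / n -> 0, which form the set E_phi(alpha);
    - the points for which 0 is a cluster point of G_n(x) / n.
    Summation by parts with decreasing weights shows that the weighted means
    are averages of the G_k / k in which each fixed k has a vanishing share, as
    S_n tends to infinity.  Hence convergence of G_n / n to 0 implies
    convergence of the weighted means, and if the weighted means tend to 0 then
    G_n / n can stay neither above e nor below - e; as the steps of G_n are
    bounded, G_n / n cannot jump over [- e, e] either, so 0 is a cluster point.

    It remains to see that the two extreme sets have the same entropy
    (htop_sandwich).  Let W_n(e) be the set of the words of length n that begin
    some point x with |G_n(x)| <= e n, and let h > 0.
    - If for some e one has #W_n(e) <= exp(h n) for all large n, the cylinders
      over W_n(e), n >= N, cover the larger set for every N, so that its entropy
      is at most h (htop_le_prefix_count).
    - Otherwise, for every e, #W_n(e) > exp(h n) for infinitely many n.  By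
      irreducibility each word of W_n(e) can be completed to a loop at a fixed
      symbol, at a cost bounded independently of n (loop_families).  Loops can
      be concatenated freely.  Concatenating loops with e -> 0, where the
      length of the next loop is always negligible against the length already
      written, produces points with G_n(x) / n -> 0.  A mass distribution
      argument on this tree of points (product_not_covered, htop_ge_mass) shows
      that the entropy of the smaller set is at least any h' < h
      (htop_ge_loops).
    If the entropy of the larger set were bigger, an h chosen strictly between
    would contradict both alternatives. *)

(** * Averages with decreasing weights *)

Lemma eventually_lt_linear (R : realType) (a c : R) : 0 < c ->
  exists N : nat, forall n, (N <= n)%N -> a < n%:R * c.
Proof.
move=> c0; exists (Num.trunc (a / c)).+1 => n Nn.
rewrite -ltr_pdivrMr//; apply: lt_le_trans (truncnS_gt _) _.
by rewrite ler_nat.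
Qed.

(** Multiplying by c n removes the quotient, so that both kinds of average are
    handled as bounds on sums. *)
Lemma cvg_ratioP (R : realType) (c T : nat -> R) (alpha : R) :
  (forall n, 0 < c n.+1) ->
  (c n)^-1 * T n @[n --> \oo] --> alpha <->
  (forall e : R, 0 < e -> exists N, forall n, (N <= n)%N ->
     `|T n - alpha * c n| <= e * c n).
Proof.
move=> c0.
have E n (e : R) : (`|alpha - (c n.+1)^-1 * T n.+1| <= e) =
    (`|T n.+1 - alpha * c n.+1| <= e * c n.+1).
  have -> : alpha - (c n.+1)^-1 * T n.+1 = - ((T n.+1 - alpha * c n.+1) / c n.+1).
    by have := c0 n; move=> /gt_eqF/negbT cn; field.
  by rewrite normrN normrM normfV (gtr0_norm (c0 n)) ler_pdivrMr.
split.
  move=> /cvgrPdist_le h e e0; have [N _ HN] := h e e0.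
  exists N.+1 => -[//|n] Nn; rewrite -E; exact: HN n.+1 (ltnW Nn).
move=> h; apply/cvgrPdist_le => e e0; have [N HN] := h e e0.
exists N.+1 => // -[//|n] /= Nn; have := HN n.+1 (ltnW Nn).
by rewrite -E.
Qed.

(** Summation by parts: the left-hand side of the invariant exceeds the bound by
    s n times the nonnegative amount by which the n-th partial sum exceeds - C,
    and lowering s n to s n.+1 only makes it smaller. *)
Lemma abel_ge (R : realType) (s u : nat -> R) (C : R) :
  (forall n, 0 < s n) -> (forall m n, (m <= n)%N -> s n <= s m) ->
  (forall n, - C <= \sum_(0 <= k < n) u k) ->
  forall n, - (C * s 0%N) <= \sum_(0 <= k < n) s k * u k.
Proof.
move=> s0 sd uC n; suff: s n * (\sum_(0 <= k < n) u k + C) - C * s 0%N <=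
    \sum_(0 <= k < n) s k * u k.
  apply: le_trans; rewrite lerDr// mulr_ge0//; first exact: ltW.
  by rewrite -lerBlDr sub0r.
elim: n => [|n IH]; first by rewrite !big_geq// add0r mulrC subrr.
rewrite big_nat_recr//= [leRHS]big_nat_recr//=.
have UC := uC n.+1; rewrite big_nat_recr//= in UC.
have := sd n n.+1 (leqnSn n); have := s0 n.+1; nra.
Qed.

(** The case of [abel_ge] for u - e: a linear lower bound for the partial sums
    passes to the weighted sums with the same slope. *)
Lemma abel_le (R : realType) (s u : nat -> R) (e C : R) :
  (forall n, 0 < s n) -> (forall m n, (m <= n)%N -> s n <= s m) ->
  (forall n, e * n%:R - C <= \sum_(0 <= k < n) u k) ->
  forall n, e * \sum_(0 <= k < n) s k - C * s 0%N <= \sum_(0 <= k < n) s k * u k.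
Proof.
move=> s0 sd uC n.
have := @abel_ge R s (fun k => u k - e) C s0 sd.
have Es m : \sum_(0 <= k < m) (u k - e) = \sum_(0 <= k < m) u k - e * m%:R.
  by rewrite sumrB sumr_const_nat subn0 mulr_natr.
have -> : \sum_(0 <= k < n) s k * u k =
    \sum_(0 <= k < n) s k * (u k - e) + e * \sum_(0 <= k < n) s k.
  by rewrite mulr_sumr -big_split/=; apply: eq_bigr => k _; ring.
move=> /(_ _ n) H; rewrite [leLHS]addrC lerD2r; apply: H => m.
by rewrite Es; have := uC m; lra.
Qed.

(** The constant absorbs the defects of the finitely many exceptional indices. *)
Lemma eventually_ge_linear (R : realType) (U : nat -> R) (e : R) (N : nat) :
  (forall n, (N <= n)%N -> e * n%:R <= U n) ->
  exists C, 0 <= C /\ forall n, e * n%:R - C <= U n.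
Proof.
move=> H; exists (\sum_(0 <= k < N) `|e * k%:R - U k|); split=> [|n].
  exact: sumr_ge0.
have [Nn|nN] := leqP N n.
  by apply: le_trans (H n Nn); rewrite gerBl sumr_ge0.
rewrite lerBlDr -lerBlDl; apply: le_trans (ler_norm _) _.
rewrite (bigD1_seq n) ?iota_uniq//= ?mem_index_iota//.
by rewrite lerDl sumr_ge0.
Qed.

Section weights.
Context (R : realType) (s : nat -> R).
Hypotheses (s_gt0 : forall n, 0 < s n)
  (s_decr : forall m n, (m <= n)%N -> s n <= s m)
  (S_lim : (\sum_(0 <= k < n) s k) @[n --> \oo] --> +oo).

(** If the partial sums U n stayed outside [- e n, e n] from some N on, they would
    keep a constant sign, since a step is at most M and M < e N for N large; then
    [abel_le], applied to u or to - u, keeps the weighted means away from 0. *)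
Lemma weighted_null_cluster (u : nat -> R) (M : R) :
  (forall k, `|u k| <= M) ->
  (forall e : R, 0 < e -> exists N, forall n, (N <= n)%N ->
     `|\sum_(0 <= k < n) s k * u k| <= e * \sum_(0 <= k < n) s k) ->
  forall (e : R) (N : nat), 0 < e ->
    exists2 n, (N <= n)%N & `|\sum_(0 <= k < n) u k| <= e * n%:R.
Proof.
(* a one-sided linear bound for the partial sums passes to the weighted sums *)
have side (v : nat -> R) e N : 0 < e ->
    (forall e : R, 0 < e -> exists N, forall n, (N <= n)%N ->
     `|\sum_(0 <= k < n) s k * v k| <= e * \sum_(0 <= k < n) s k) ->
    (forall n, (N <= n)%N -> e * n%:R <= \sum_(0 <= k < n) v k) -> False.
  move=> e0 vlim /eventually_ge_linear[C [C0 HC]].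
  have [N1 HN1] := vlim (e / 2) ltac:(lra).
  have /cvgryPgt/(_ (C * s 0%N * 2 / e)) [N2 _ HN2] := S_lim.
  have := HN2 (maxn N1 N2) (leq_maxr _ _).
  have := HN1 (maxn N1 N2) (leq_maxl _ _).
  have := abel_le s_gt0 s_decr HC (maxn N1 N2).
  set n := maxn _ _ => H1 /(le_trans (ler_norm _)) H2 /=.
  rewrite ltr_pdivrMr// => H3; lra.
move=> uM ulim e N e0; apply: contrapT => H.
have {}H n : (N <= n)%N -> e * n%:R < `|\sum_(0 <= k < n) u k|.
  by move=> Nn; rewrite ltNge; apply/negP => h; apply: H; exists n.
have M0 : 0 <= M := le_trans (normr_ge0 _) (uM 0%N).
have [N1 HN1] := eventually_lt_linear M e0.
pose N2 := maxn N N1.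
(* a sign change of the partial sums beyond N2 would need a step larger than M *)
have step n : (N2 <= n)%N -> (0 < \sum_(0 <= k < n) u k) =
   (0 < \sum_(0 <= k < n.+1) u k).
  rewrite geq_max => /andP[Nn N1n].
  have := H n Nn; have := H n.+1 (leq_trans Nn (leqnSn n)).
  rewrite big_nat_recr//= -natr1; have := uM n.
  have := HN1 n N1n.
  move: (\sum_(0 <= k < n) u k) => U; move: n%:R => m.
  rewrite ler_norml => nm /andP[u1 u2].
  have [U0|U0] := lerP U 0; have [U1|U1] := lerP (U + u n) 0 => //.
    by rewrite (ler0_norm U0) gtr0_norm// => *; exfalso; lra.
  by rewrite (gtr0_norm U0) ler0_norm// => *; exfalso; lra.
have sgn k : (0 < \sum_(0 <= k < N2 + k) u k) = (0 < \sum_(0 <= k < N2) u k).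
  by elim: k => [|k <-]; rewrite ?addn0// addnS -step// leq_addr.
have [P|P] := ltrP 0 (\sum_(0 <= k < N2) u k).
  apply: (side u e N2 e0 ulim) => n N2n.
  have := H n (leq_trans (leq_maxl _ _) N2n).
  by rewrite gtr0_norm; [exact: ltW|rewrite -(subnKC N2n) sgn].
apply: (side (fun k => - u k) e N2 e0).
  move=> e' /ulim[N' HN']; exists N' => n /HN'.
  have -> : \sum_(0 <= k < n) s k * - u k = - \sum_(0 <= k < n) s k * u k.
    by rewrite -sumrN; apply: eq_bigr => k _; rewrite mulrN.
  by rewrite normrN.
move=> n N2n; rewrite sumrN.
have := H n (leq_trans (leq_maxl _ _) N2n).
rewrite ler0_norm; first exact: ltW.
by rewrite leNgt -(subnKC N2n) sgn -leNgt.
Qed.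

Lemma cesaro_null_weighted_null (u : nat -> R) :
  (forall e : R, 0 < e -> exists N, forall n, (N <= n)%N ->
     `|\sum_(0 <= k < n) u k| <= e * n%:R) ->
  (forall e : R, 0 < e -> exists N, forall n, (N <= n)%N ->
     `|\sum_(0 <= k < n) s k * u k| <= e * \sum_(0 <= k < n) s k).
Proof.
have side (v : nat -> R) e : 0 < e ->
    (forall e : R, 0 < e -> exists N, forall n, (N <= n)%N ->
     `|\sum_(0 <= k < n) v k| <= e * n%:R) ->
    exists N, forall n, (N <= n)%N ->
     - (e * \sum_(0 <= k < n) s k) <= \sum_(0 <= k < n) s k * v k.
  move=> e0 vlim; have [N HN] := vlim (e / 2) ltac:(lra).
  have [|C [C0 HC]] := @eventually_ge_linear R (fun n => \sum_(0 <= k < n) v k) (- (e / 2)) N.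
    by move=> n /HN; rewrite ler_norml => /andP[]; lra.
  have /cvgryPgt/(_ (C * s 0%N * 2 / e)) [N2 _ HN2] := S_lim.
  exists N2 => n /HN2 /=; have := abel_le s_gt0 s_decr HC n.
  by rewrite ltr_pdivrMr//; lra.
move=> ulim e e0.
have [N1 H1] := side u e e0 ulim.
have [|N2 H2] := side (fun k => - u k) e e0.
  by move=> e' /ulim[N' HN']; exists N' => n /HN'; rewrite sumrN normrN.
exists (maxn N1 N2) => n; rewrite geq_max => /andP[/H1 h1 /H2].
have -> : \sum_(0 <= k < n) s k * - u k = - \sum_(0 <= k < n) s k * u k.
  by rewrite -sumrN; apply: eq_bigr => k _; rewrite mulrN.
by rewrite lerN2 => h2; rewrite ler_norml h1.
Qed.

End weights.

(** * Cylinders of the full shift *)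

Definition agree (T : Type) (n : nat) (x y : nat -> T) : Prop :=
  forall i, (i < n)%N -> x i = y i.

Lemma agree_sym T n (x y : nat -> T) : agree n x y -> agree n y x.
Proof. by move=> h i /h. Qed.

Lemma agree_trans T n (x y z : nat -> T) :
  agree n x y -> agree n y z -> agree n x z.
Proof. by move=> h g i ni; rewrite h// g. Qed.

Lemma agree_le T m n (x y : nat -> T) : (m <= n)%N -> agree n x y -> agree m x y.
Proof. by move=> mn h i im; apply: h; apply: leq_trans mn. Qed.

(** Dependent choice for sequences built one coordinate at a time, for properties
    of the first n coordinates.  This is the form of Koenig's lemma used both for
    compactness and for the choice of a point outside a cover. *)
Lemma agree_extend T (P : nat -> (nat -> T) -> Prop) (x0 : nat -> T) :
  (forall n x y, agree n x y -> P n x -> P n y) ->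
  P 0%N x0 ->
  (forall n x, P n x -> exists2 y, agree n x y & P n.+1 y) ->
  exists x, forall n, P n x.
Proof.
move=> Pagree P0 Pstep.
have /choice[F HF] : forall nx : nat * (nat -> T), exists y,
    P nx.1 nx.2 -> agree nx.1 nx.2 y /\ P nx.1.+1 y.
  move=> [n x]; have [/Pstep[y xy Py]|nP] := pselect (P n x).
    by exists y => _; split.
  by exists x => /nP.
pose X := fix X n := if n is m.+1 then F (m, X m) else x0.
have XP n : P n (X n) by elim: n => // n /(HF (n, X n))[].
have XS n : agree n (X n) (X n.+1) by have [] := HF (n, X n) (XP n).
have XX n k : agree n (X n) (X (n + k)%N).
  elim: k => [|k IH]; first by rewrite addn0.
  rewrite addnS; apply: agree_trans IH _.
  exact: agree_le (leq_addr _ _) (XS _).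
exists (fun n => X n.+1 n) => n; apply: Pagree (XP n) => i ni.
by rewrite -(subnKC ni) -(XX i.+1 (n - i.+1)%N).
Qed.

Section shift.
Context (R : realType) (K : nat).
Local Notation X := (shift_space R K).
Local Notation shift := (@left_shift R K).

Lemma iter_shiftE k (x : X) i : iter k shift x i = x (k + i)%N.
Proof. by elim: k i => // k IH i; rewrite iterS /left_shift IH addnS. Qed.

Lemma agree_shift k n (x y : X) :
  agree (k + n) x y -> agree n (iter k shift x) (iter k shift y).
Proof. by move=> xy i ni; rewrite !iter_shiftE xy// ltn_add2l. Qed.

Lemma subshift_shift (A : 'M[nat]_K) k (x : X) :
  subshift A x -> subshift A (iter k shift x).
Proof. by move=> xA i; rewrite !iter_shiftE addnS; apply: xA. Qed.

Definition cylinder n (x : X) : set X := [set y | agree n x y].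

Lemma ball_agree n (x y : X) : ball x (expR (- n%:R)) y -> agree n x y.
Proof. by rewrite ballEmdist => /ltW/shift_dist_le. Qed.

Lemma nbhs_agree (x : X) (V : set X) :
  nbhs x V -> exists n, forall y, agree n x y -> V y.
Proof.
rewrite -nbhs_ballE => -[e /= e0 eV].
exists (Num.trunc (- ln e)).+1 => y /shift_dist_le xy; apply: eV.
rewrite ballEmdist /=; apply: le_lt_trans xy _.
by rewrite -[ltRHS]lnK ?posrE// ltr_expR ltrNl truncnS_gt.
Qed.

Lemma open_cylinder n (x : X) : open (cylinder n x).
Proof.
rewrite openE => y /= xy; apply/nbhs_ballP.
exists (expR (- n%:R)) => /=; first exact: expR_gt0.
move=> z yz; apply: agree_trans xy _.
exact: ball_agree.
Qed.

(** Compactness of the full shift.  Call a cylinder bad if for every N it meets a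
    cylinder over N coordinates that violates Q.  If the conclusion fails, the whole
    space is bad, and a bad cylinder contains a bad one with one more coordinate,
    the alphabet being finite.  A point all of whose cylinders are bad contradicts
    the local hypothesis. *)
Lemma cylinder_compact (Q : set X -> Prop) :
  (forall C D : set X, C `<=` D -> Q D -> Q C) ->
  (forall x, exists n, Q (cylinder n x)) ->
  exists n, forall x, Q (cylinder n x).
Proof.
move=> Qsub Qloc; apply: contrapT => nQ.
pose bad n (x : X) := forall N, exists2 y : X, agree n x y & ~ Q (cylinder N y).
have [x0 _] : exists2 x : X, True & ~ Q (cylinder 0 x).
  apply: contrapT => h; apply: nQ; exists 0%N => x.
  by apply: contrapT => h'; apply: h; exists x.
have [] := @agree_extend 'I_K bad x0.
- move=> n x y xy xbad N; have [z xz zN] := xbad N; exists z => //.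
  exact: agree_trans (agree_sym xy) xz.
- move=> N; apply: contrapT => h; apply: nQ; exists N => x.
  by apply: contrapT => h'; apply: h; exists x.
- move=> n x xbad; apply: contrapT => nstep.
  have /choice[N HN] : forall a : 'I_K, exists N,
      forall y : X, agree n x y -> y n = a -> Q (cylinder N y).
    move=> a; apply: contrapT => h; apply: nstep.
    exists (fun i => if (i < n)%N then x i else a) => [i ->//|N].
    apply: contrapT => h'; apply: h; exists N => y xy ya.
    apply: contrapT => h''; apply: h'; exists y => // i.
    by rewrite ltnS; have [/xy//|ni] := ltnP i n => ni'; rewrite -ya (@anti_leq i n)// ni ni'.
  have [y xy] := xbad (\max_a N a)%N; case.
  apply: Qsub (HN (y n) y xy erefl) => z; apply: agree_le.
  exact: leq_bigmax.
- move=> x xbad; have [n Qn] := Qloc x.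
  have [y xy] := xbad n n; case.
  by apply: Qsub Qn => z; apply: agree_trans.
Qed.

End shift.

(** * Birkhoff sums of a continuous potential *)

Section potential.
Context (R : realType) (K : nat).
Local Notation X := (shift_space R K).
Local Notation shift := (@left_shift R K).

Definition birkhoff_sum (g : X -> R) n (x : X) : R :=
  \sum_(0 <= k < n) g (iter k shift x).

Lemma birkhoff_sumD g m n x :
  birkhoff_sum g (m + n) x = birkhoff_sum g m x + birkhoff_sum g n (iter m shift x).
Proof.
rewrite /birkhoff_sum (big_cat_nat (n := m)) ?leq_addr//=; congr (_ + _).
rewrite -{1}[m]add0n big_addn addKn.
by apply: eq_bigr => i _; rewrite iterD.
Qed.

Lemma birkhoff_sumBr g c n x :
  birkhoff_sum (fun x => g x - c) n x = birkhoff_sum g n x - c * n%:R.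
Proof.
by rewrite /birkhoff_sum sumrB sumr_const_nat subn0 mulr_natr.
Qed.

Section bounded.
Context (A : 'M[nat]_K) (g : X -> R) (M : R).
Hypothesis gM : forall x, subshift A x -> `|g x| <= M.

Lemma birkhoff_sum_bound n x : subshift A x -> `|birkhoff_sum g n x| <= M * n%:R.
Proof.
move=> xA; apply: le_trans (ler_norm_sum _ _ _) _.
apply: le_trans (ler_sum_nat (G := fun=> M) _) _ => [i _|].
  exact/gM/subshift_shift.
by rewrite sumr_const_nat subn0 mulr_natr.
Qed.

Hypothesis g_unif : forall e : R, 0 < e -> exists N, forall x y,
  subshift A x -> subshift A y -> agree N x y -> `|g x - g y| <= e.

(** Two points that agree on n coordinates have orbits that agree on N
    coordinates, hence nearly equal values of g, except for the last N terms,
    which contribute a bounded amount. *)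
Lemma birkhoff_sum_variation (e : R) : 0 < e -> exists N, forall n x y, (N <= n)%N ->
  subshift A x -> subshift A y -> agree n x y ->
  `|birkhoff_sum g n x - birkhoff_sum g n y| <= e * n%:R.
Proof.
move=> e0; have [N HN] := g_unif (e := e / 2) ltac:(lra).
have [N' HN'] := eventually_lt_linear (4 * M * N%:R) e0.
exists (N + N')%N => n x y Nn xA yA xy.
have Nn' : (N <= n)%N by apply: leq_trans Nn; apply: leq_addr.
have nbig := HN' n (leq_trans (leq_addl _ _) Nn).
have E : n = (n - N + N)%N by rewrite subnK.
rewrite E !birkhoff_sumD -E.
have := birkhoff_sum_bound N (subshift_shift (n - N) xA).
have := birkhoff_sum_bound N (subshift_shift (n - N) yA).
have : `|birkhoff_sum g (n - N) x - birkhoff_sum g (n - N) y| <= e / 2 * n%:R.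
  rewrite -sumrB; apply: le_trans (ler_norm_sum _ _ _) _.
  apply: le_trans (ler_sum_nat (G := fun=> e / 2) _) _ => [i /andP[_ iN]|].
    apply: HN; [exact: subshift_shift|exact: subshift_shift|].
    by apply: agree_shift; apply: agree_le xy; lia.
  rewrite sumr_const_nat subn0 -[leLHS]mulr_natr ler_pM2l ?ler_nat ?leq_subr//; lra.
move: (birkhoff_sum g (n - N) x) (birkhoff_sum g (n - N) y).
move: (birkhoff_sum g N _) (birkhoff_sum g N _) => a b c d.
by rewrite !ler_norml => /andP[? ?] /andP[? ?] /andP[? ?]; apply/andP; split; lra.
Qed.

End bounded.

Section continuous.
Context (A : 'M[nat]_K) (phi : X -> R).
Hypothesis phi_cont : {within subshift A, continuous phi}.

Lemma subshift_complement_open (x : X) : ~ subshift A x ->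
  exists n, forall y : X, agree n x y -> ~ subshift A y.
Proof.
move=> nxA; have [k xk] : exists k, A (x k) (x k.+1) <> 1%N.
  by apply: contrapT => h; apply: nxA => k; apply: contrapT => xk; apply: h; exists k.
by exists k.+2 => y xy yA; apply: xk; rewrite !xy.
Qed.

(** Outside the closed subshift the property holds vacuously on a small
    cylinder, so compactness of the full shift suffices. *)
Lemma uniform_continuity (e : R) : 0 < e -> exists N, forall x y : X,
  subshift A x -> subshift A y -> agree N x y -> `|phi x - phi y| <= e.
Proof.
move=> e0; have [|x|N HN] := @cylinder_compact R K (fun C => forall x y, C x -> C y ->
    subshift A x -> subshift A y -> `|phi x - phi y| <= e).
- by move=> C D CD h x y /CD Dx /CD Dy; apply: h.
- have [xA|/subshift_complement_open[n xn]] := pselect (subshift A x); last first.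
    by exists n => y z /xn.
  have /subspace_continuousP/(_ x xA)/cvgrPdist_lt/(_ (e / 2)) := phi_cont.
  have e20 : 0 < e / 2 by lra.
  move=> /(_ e20) /nbhs_agree[n Hn].
  exists n => y z /Hn Hy /Hn Hz /Hy {}Hy /Hz {}Hz.
  have {}Hy : `|phi x - phi y| < e / 2 by exact: Hy.
  have {}Hz : `|phi x - phi z| < e / 2 by exact: Hz.
  move: Hy Hz; rewrite !ltr_norml ler_norml.
  by move=> /andP[? ?] /andP[? ?]; apply/andP; split; lra.
- by exists N => x y xA yA xy; apply: (HN x).
Qed.

(** Words are finite functions, so that sets of words of length n are finite sets
    with a cardinal. *)
Definition prefix n (x : nat -> 'I_K) : {ffun 'I_n -> 'I_K} := [ffun i : 'I_n => x i].

Lemma prefixP n (x y : nat -> 'I_K) : prefix n x = prefix n y <-> agree n x y.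
Proof.
split=> [/ffunP h i ni|h].
  by have := h (Ordinal ni); rewrite !ffunE.
by apply/ffunP => i; rewrite !ffunE h.
Qed.

Lemma continuous_bounded : exists M, forall x : X, subshift A x -> `|phi x| <= M.
Proof.
have [N HN] := uniform_continuity ltr01.
have /choice[m Hm] : forall w : {ffun 'I_N -> 'I_K}, exists m, 0 <= m /\
    forall y : X, subshift A y -> prefix N y = w -> `|phi y| <= m.
  move=> w; have [[x [xA xw]]|h] := pselect (exists x : X, subshift A x /\ prefix N x = w).
    exists (`|phi x| + 1); split=> [|y yA yw]; first by rewrite addr_ge0.
    rewrite -lerBlDl; apply: le_trans (lerB_dist _ _) _.
    by apply: HN => //; apply/prefixP; rewrite xw yw.
  by exists 0; split=> // y yA yw; exfalso; apply: h; exists y.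
exists (\sum_w m w) => x xA; apply: le_trans (proj2 (Hm (prefix N x)) x xA erefl) _.
rewrite (bigD1 (prefix N x))//= lerDl sumr_ge0// => w _.
by case: (Hm w).
Qed.

End continuous.
End potential.

(** * Bowen entropy *)

(** An enumeration of the pairs turns a family indexed by two integers into a
    sequence, which is the form of cover that Bowen's premeasure accepts. *)
Lemma nneseries_pairs (R : realType) (a : nat -> nat -> \bar R) :
  (forall i j, 0 <= a i j)%E ->
  exists2 f : nat -> nat * nat, (forall ij, exists m, f m = ij) &
    (\sum_(m <oo) a (f m).1 (f m).2 = \sum_(i <oo) \sum_(j <oo) a i j)%E.
Proof.
move=> a0; have /card_esym/ppcard_eqP[f] := card_nat2.
exists f => [ij|].
  by exists (f^-1%FUN ij); rewrite invK ?inE.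
rewrite nneseries_esumT// nneseries_esumT; last by move=> i; exact: nneseries_ge0.
rewrite (eq_esum (fun i _ => nneseries_esumT (a0 i))) esum_esum//.
rewrite [RHS](reindex_esum [set: nat] _ f)//.
rewrite (_ : [set: nat] `*`` _ = setT); first exact: bij.
by apply/seteqP; split.
Qed.

Lemma nneseries_finite (R : realType) (a : nat -> \bar R) n (c : R) :
  (forall j, (j < n)%N -> (a j <= c%:E)%E) -> (forall j, (0 <= a j)%E) ->
  (forall j, (n <= j)%N -> a j = 0%E) -> (\sum_(j <oo) a j <= (n%:R * c)%:E)%E.
Proof.
move=> ac a0 a0n; rewrite (nneseries_split 0 n); last by move=> *.
rewrite add0n [X in (_ + X)%E]eseries0 ?adde0; last by move=> j nj _; exact: a0n.
apply: (@le_trans _ _ (\sum_(0 <= j < n) c%:E)%E).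
  by rewrite !big_mkord; apply: lee_sum => j _; exact: ac.
by rewrite sumEFin sumr_const_nat subn0 mulr_natl.
Qed.

Section bowen.
Context (R : realType) (X : topologicalType) (T : X -> X).
Implicit Types (U : set (set X)) (Y E : set X) (lambda eps : R).
Local Open Scope ereal_scope.

Lemma cover_time_ge U E n :
  (forall k, (k < n)%N -> exists2 V, U V & iter k T @` E `<=` V) ->
  n%:R%:E <= cover_time R T U E.
Proof. by move=> h; apply: ereal_sup_ubound; exists n. Qed.

Lemma cover_diam_ge0 U E : 0 <= cover_diam R T U E.
Proof. exact: expeR_ge0. Qed.

Lemma cover_diam_le U E n :
  (forall k, (k < n)%N -> exists2 V, U V & iter k T @` E `<=` V) ->
  cover_diam R T U E <= (expR (- n%:R))%:E.
Proof.
move=> /cover_time_ge h; have -> : (expR (- n%:R))%:E = expeR (- n%:R%:E) :> \bar R by [].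
by rewrite lee_expeR leeN2.
Qed.

Lemma cover_diam_set0 U V : U V -> cover_diam R T U set0 = 0.
Proof.
move=> UV; apply/eqP; rewrite eq_le cover_diam_ge0 andbT.
suff -> : cover_diam R T U set0 = expeR -oo by [].
congr expeR; rewrite (_ : cover_time _ _ _ _ = +oo)//.
apply/eqyP => r r0; apply: le_trans (cover_time_ge (n := (Num.trunc r).+1) _).
  by rewrite lee_fin ltW// truncnS_gt.
by move=> k _; exists V => //; rewrite image_set0.
Qed.

Lemma bowen_premeasure_ge0 U lambda Y eps : 0 <= bowen_premeasure T U lambda Y eps.
Proof.
apply: le_ereal_inf_tmp => _ [E _ <-]; apply: nneseries_ge0 => n _ _; exact: poweR_ge0.
Qed.

Lemma bowen_premeasure_nincr U lambda Y (e1 e2 : R) : (e1 <= e2)%R ->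
  bowen_premeasure T U lambda Y e2 <= bowen_premeasure T U lambda Y e1.
Proof.
move=> e12; apply: le_ereal_inf => _ [E [YE Ee] <-]; exists E => //; split=> // n.
by apply: lt_le_trans (Ee n) _; rewrite lee_fin.
Qed.

Lemma bowen_measure_eq0 U lambda Y :
  (forall eps : R, (0 < eps)%R -> bowen_premeasure T U lambda Y eps = 0) ->
  bowen_measure T U lambda Y = 0.
Proof.
move=> h; apply: lim_near_cst => //; near=> e; apply: h; near: e.
exact: nbhs_right_gt.
Unshelve. all: by end_near. Qed.

(** The premeasure is monotone in the mesh, so the limit that defines the
    measure exists. *)
Lemma bowen_measure_ge U lambda Y (c : \bar R) :
  (forall eps : R, (0 < eps)%R -> c <= bowen_premeasure T U lambda Y eps) ->
  c <= bowen_measure T U lambda Y.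
Proof.
move=> h; apply: lime_ge.
  apply: nonincreasing_at_right_is_cvge; near=> x => e1 e2 _ _.
  exact: bowen_premeasure_nincr.
near=> e; apply: h; near: e; exact: nbhs_right_gt.
Unshelve. all: by end_near. Qed.

Lemma bowen_cover_entropy_ge0 U Y : 0 <= bowen_cover_entropy R T U Y.
Proof. by apply: le_ereal_inf_tmp => _ [l [l0 _] <-]; rewrite lee_fin ltW. Qed.

Lemma finite_open_coverT : @finite_open_cover X [set [set: X]].
Proof. by split=> [|V ->|]; [exact: finite_set1|exact: openT|rewrite bigcup_set1]. Qed.

Lemma bowen_entropy_ge0 Y : 0 <= bowen_entropy R T Y.
Proof.
apply: le_trans (bowen_cover_entropy_ge0 [set [set: X]] Y) _.
by apply: ereal_sup_ubound; exists [set [set: X]] => //; exact: finite_open_coverT.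
Qed.

End bowen.

(** * Entropy of subsets of the full shift *)

Lemma expR_small (R : realType) (c e : R) : 0 < c -> 0 < e ->
  exists N : nat, forall n, (N <= n)%N -> expR (- (c * n%:R)) < e.
Proof.
move=> c0 e0; have [N HN] := eventually_lt_linear (- ln e) c0.
exists N => n /HN Nn.
by rewrite -[ltRHS]lnK ?posrE// ltr_expR ltrNl mulrC.
Qed.

Lemma poweR_expR (R : realType) (x lambda : R) :
  poweR (expR x)%:E lambda = (expR (lambda * x))%:E.
Proof. by rewrite poweR_EFin -expRM mulrC. Qed.

Section symbolic_entropy.
Context (R : realType) (K : nat).
Hypothesis K_gt0 : (0 < K)%N.
Local Notation X := (shift_space R K).
Local Notation shift := (@left_shift R K).

(** Compactness gives one N for which every cylinder over N coordinates lies in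
    a member of the cover; a set whose points agree on n coordinates then has cover
    time at least n - N. *)
Lemma lebesgue_number (U : set (set X)) : finite_open_cover U ->
  exists N, forall x : X, exists2 V, U V & cylinder N x `<=` V.
Proof.
move=> [_ openU coverU].
apply: (@cylinder_compact R K (fun C => exists2 V, U V & C `<=` V)).
  by move=> C D CD [V UV DV]; exists V => //; exact: subset_trans DV.
move=> x; have [V UV Vx] : (\bigcup_(V in U) V) x by rewrite coverU.
have [n nV] := nbhs_agree (open_nbhs_nbhs (conj (openU V UV) Vx)).
by exists n, V.
Qed.

Lemma cover_diam_agree (U : set (set X)) N (C : set X) n :
  (forall x : X, exists2 V, U V & cylinder N x `<=` V) ->
  (forall x y, C x -> C y -> agree n x y) ->
  (cover_diam R shift U C <= (expR (- (n - N)%:R))%:E)%E.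
Proof.
move=> UN Cn; have [[x Cx]|C0] := pselect (exists x, C x); last first.
  have -> : C = set0 by apply/seteqP; split=> // x Cx; exfalso; apply: C0; exists x.
  have [V UV _] := UN (fun=> Ordinal K_gt0).
  by rewrite (cover_diam_set0 _ _ UV) lee_fin expR_ge0.
apply: cover_diam_le => k kn; have [V UV xV] := UN (iter k shift x).
exists V => //; apply: subset_trans xV => _ [y Cy <-].
by apply: agree_shift; apply: agree_le (Cn _ _ Cx Cy); lia.
Qed.

(** Every point of Y begins with words of W n for arbitrarily large n, so the
    cylinders over W n with n >= N0 cover Y for each N0.  For lambda = h + e their
    total weight is at most a constant times the tail of a geometric series of
    ratio exp (- e), which is as small as desired. *)
Lemma htop_le_prefix_count (Y : set X) (W : forall n, {set {ffun 'I_n -> 'I_K}})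
    (h : R) (n1 : nat) :
  0 <= h ->
  (forall x N, Y x -> exists2 n, (N <= n)%N & prefix n x \in W n) ->
  (forall n, (n1 <= n)%N -> #|W n|%:R <= expR (h * n%:R)) ->
  (htop Y <= h%:E)%E.
Proof.
move=> h0 YW Wh; apply: ge_ereal_sup => _ [U Ucover <-].
have [N UN] := lebesgue_number Ucover.
apply/lee_addgt0Pr => e e0; rewrite -EFinD.
apply: ereal_inf_lbound; exists (h + e) => //; split; first by lra.
set lambda := h + e.
apply: bowen_measure_eq0 => eps eps0; apply/eqP; rewrite eq_le.
rewrite bowen_premeasure_ge0 andbT; apply/lee_addgt0Pr => d d0; rewrite add0e.
(* Half of the decay exp (- e n) is spent on smallness for n >= N0 and half on
   summability, so that the series starts at 0. *)
pose p := expR (- (e / 2)).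
have p0 : 0 < p := expR_gt0 _.
have p1 : p < 1 by rewrite -expR0 ltr_expR; lra.
pose a := expR (lambda * N%:R).
have a0 : 0 < a := expR_gt0 _.
have e20 : 0 < e / 2 by lra.
have d'0 : 0 < d * (1 - p) / a by rewrite divr_gt0// mulr_gt0// subr_gt0.
have [N2 HN2] := expR_small e20 d'0.
have [N3 HN3] := expR_small ltr01 eps0.
pose N0 := (n1 + N + N2 + N3)%N.
(* All points with the j-th word of W n; empty for the other indices. *)
pose G n j : set X := [set x | [/\ (N0 <= n)%N, prefix n x \in W n &
  index (prefix n x) (enum (W n)) = j]].
have Gdiam n j : (N0 <= n)%N ->
    (cover_diam R shift U (G n j) <= (expR (- (n - N)%:R))%:E)%E.
  move=> _; apply: cover_diam_agree UN _ => x y [_ xW xj] [_ yW yj].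
  apply/prefixP.
  have := nth_index (prefix n x) (s := enum (W n)) (x := prefix n x).
  rewrite mem_enum => /(_ xW) <-.
  have := nth_index (prefix n x) (s := enum (W n)) (x := prefix n y).
  by rewrite mem_enum => /(_ yW) <-; rewrite xj yj.
have G0 n j : ~~ ((N0 <= n)%N && (j < #|W n|)%N) -> cover_diam R shift U (G n j) = 0%E.
  move=> nj; rewrite (_ : G n j = set0).
    by have [V UV _] := UN (fun=> Ordinal K_gt0); exact: cover_diam_set0 UV.
  apply/seteqP; split=> // x [N0n xW xj]; move: nj.
  by rewrite N0n -xj cardE index_mem mem_enum xW.
have [f fsurj fsum] := nneseries_pairs (a := fun n j => poweR (cover_diam R shift U (G n j)) lambda)
  (fun n j => poweR_ge0 _ _).
apply: (@le_trans _ _ (\sum_(m <oo) poweR (cover_diam R shift U (G (f m).1 (f m).2)) lambda)%E).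
  apply: ereal_inf_lbound; exists (fun m => G (f m).1 (f m).2) => //; split.
    move=> x Yx; have [n N0n xW] := YW x N0 Yx.
    have [m fm] := fsurj (n, index (prefix n x) (enum (W n))).
    by exists m => //; rewrite fm.
  move=> m; have [N0n|nN0] := leqP N0 (f m).1; last first.
    by rewrite G0 ?lte_fin// leqNgt nN0.
  apply: le_lt_trans (Gdiam _ _ N0n) _.
  by rewrite lte_fin -[X in - X]mul1r HN3//; rewrite /N0 in N0n; lia.
rewrite fsum.
have level n : (\sum_(j <oo) poweR (cover_diam R shift U (G n j)) lambda <=
    (a * p ^+ N0 * p ^+ n)%:E)%E.
  have lambda0 : lambda != 0 by rewrite /lambda; lra.
  have pe m : p ^+ m = expR (- (e / 2) * m%:R) by rewrite /p -expRM_natr.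
  have [N0n|nN0] := leqP N0 n; last first.
    rewrite eseries0 => [|j _ _]; last by rewrite G0 ?poweR0r// leqNgt nN0.
    by rewrite lee_fin !mulr_ge0// ?exprn_ge0// ltW.
  apply: (@le_trans _ _ (#|W n|%:R * expR (lambda * - (n - N)%:R))%:E).
    apply: nneseries_finite => j.
    - move=> _; rewrite -poweR_expR; apply: gt0_ler_poweR; last exact: Gdiam.
      + by rewrite /lambda; lra.
      + by rewrite in_itv/= cover_diam_ge0 leey.
      + by rewrite in_itv/= leey lee_fin expR_ge0.
    - exact: poweR_ge0.
    - by move=> Wj; rewrite G0 ?poweR0r// negb_and -leqNgt Wj orbT.
  rewrite lee_fin; apply: le_trans (ler_wpM2r (expR_ge0 _) (Wh n _)) _.
    by rewrite /N0 in N0n; lia.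
  rewrite !pe /a -!expRD ler_expR natrB; last by rewrite /N0 in N0n; lia.
  have : (N0%:R : R) <= n%:R by rewrite ler_nat.
  by move: (n%:R : R) (N0%:R : R) (N%:R : R) => x y z; rewrite /lambda; nra.
apply: (@le_trans _ _ (\sum_(n <oo) (a * p ^+ N0 * p ^+ n)%:E)%E).
  by apply: lee_nneseries => // i _ _; apply: nneseries_ge0 => j _ _; exact: poweR_ge0.
apply: lime_le.
  by apply: is_cvg_nneseries => n _ _; rewrite lee_fin !mulr_ge0// ?exprn_ge0// ltW.
apply: nearW => m; rewrite sumEFin lee_fin.
apply: le_trans (geometric_le_lim m _ p0 _) _.
- by rewrite mulr_ge0 ?exprn_ge0// ltW.
- by rewrite gtr0_norm.
have /HN2 : (N2 <= N0)%N by rewrite /N0; lia.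
rewrite -mulNr /p expRM_natr -/p ltr_pdivlMr// => H.
by rewrite ler_pdivrMr ?subr_gt0// mulrC; apply: ltW.
Qed.

(** For the partition into cylinders over one coordinate, the cover time of a set
    is the number of coordinates on which its points agree; it may be infinite,
    and then a finite n of negligible weight is used instead.  So a lower bound
    for the weights of covers by sets of points agreeing on n coordinates bounds
    the entropy for this one open cover from below, hence the topological
    entropy. *)
Lemma htop_ge_mass (Y : set X) (h : R) :
  (forall lambda : R, 0 < lambda -> lambda < h -> exists2 c : R, 0 < c &
    forall (n : nat -> nat) (E : nat -> set X), Y `<=` \bigcup_i E i ->
      (forall i x y, E i x -> E i y -> agree (n i) x y) ->
      (c%:E <= \sum_(i <oo) (expR (- (lambda * (n i)%:R)))%:E)%E) ->
  (h%:E <= htop Y)%E.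
Proof.
move=> H; pose U0 : set (set X) := [set cylinder 1 (fun=> a) | a in [set: 'I_K]].
have U0cover : finite_open_cover U0.
  split.
  - exact/finite_image/finite_finset.
  - by move=> _ [a _ <-]; exact: open_cylinder.
  - apply/seteqP; split=> // x _; exists (cylinder 1 (fun=> x 0%N)).
      by exists (x 0%N).
    by case.
apply: le_trans (ereal_sup_ubound _); last by exists U0.
apply: le_ereal_inf_tmp => _ [lambda [l0 Ml] <-]; rewrite lee_fin leNgt.
apply/negP => /(H lambda l0)[c c0 {}H].
suff : ((c / 2)%:E <= bowen_measure shift U0 lambda Y)%E.
  by rewrite Ml lee_fin; lra.
apply: bowen_measure_ge => eps eps0; apply: le_ereal_inf_tmp => _ [E [YE _] <-].
have /choice[n Hn] : forall i, exists n,
    (forall x y, E i x -> E i y -> agree n x y) /\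
    ((expR (- (lambda * n%:R)))%:E <= poweR (cover_diam R shift U0 (E i)) lambda +
      (c / 2 / (2 ^ i.+1)%:R)%:E)%E.
  (* S is the set of integers of which the cover time is the supremum. *)
  move=> i; pose S n := forall k, (k < n)%N ->
    exists2 V, U0 V & iter k shift @` E i `<=` V.
  have Sagree n : S n -> forall x y, E i x -> E i y -> agree n x y.
    move=> Sn x y Ex Ey k kn; have [_ [a _ <-] EV] := Sn k kn.
    have /(_ 0%N isT) := EV _ (ex_intro2 _ _ x Ex erefl).
    have /(_ 0%N isT) := EV _ (ex_intro2 _ _ y Ey erefl).
    by rewrite !iter_shiftE addn0 => <- <-.
  have d0 : 0 < c / 2 / (2 ^ i.+1)%:R by rewrite !divr_gt0// ltr0n expn_gt0.
  have [allS|/existsNP[m0 Sm0]] := pselect (forall n, S n).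
    have [n Hn] := expR_small l0 d0.
    exists n; split; first exact: Sagree.
    apply: (@le_trans _ _ (c / 2 / (2 ^ i.+1)%:R)%:E).
      by rewrite lee_fin ltW// Hn.
    by rewrite leeDr// poweR_ge0.
  have exS : exists n, `[< ~ S n >] by exists m0; apply/asboolP.
  case: (ex_minnP exS) => -[|m] /asboolP Sm mmin.
    by exfalso; apply: Sm.
  have mS : S m.
    by apply: contrapT => /asboolP/mmin; rewrite ltnn.
  have Sle n : S n -> (n <= m)%N.
    move=> Sn; rewrite leqNgt; apply/negP => mn; apply: Sm => k km.
    by apply: Sn; apply: leq_trans mn.
  exists m; split; first exact: Sagree.
  apply: (@le_trans _ _ (poweR (cover_diam R shift U0 (E i)) lambda)).
    rewrite -mulrN -poweR_expR; apply: gt0_ler_poweR => //; first exact: ltW.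
    + by rewrite in_itv/= leey lee_fin expR_ge0.
    + by rewrite in_itv/= cover_diam_ge0 leey.
    + have -> : (expR (- m%:R))%:E = expeR (- m%:R%:E) :> \bar R by [].
      rewrite lee_expeR leeN2; apply: ge_ereal_sup => _ [n Sn <-].
      by rewrite lee_fin ler_nat; exact: Sle.
  by rewrite leeDl// lee_fin ltW.
have d0 i : (0 <= (c / 2 / (2 ^ i.+1)%:R)%:E)%E by rewrite lee_fin !divr_ge0// ltW.
have cE : (c%:E = (c / 2)%:E + (c / 2)%:E)%E by rewrite -EFinD; congr EFin; lra.
have := H n E YE (fun i => (Hn i).1); rewrite cE => cS.
rewrite -(leeD2rE _ _ (isT : (c / 2)%:E \is a fin_num)); apply: le_trans cS _.
apply: (@le_trans _ _ (\sum_(i <oo) (poweR (cover_diam R shift U0 (E i)) lambda +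
    (c / 2 / (2 ^ i.+1)%:R)%:E))%E).
  by apply: lee_nneseries => i *; [rewrite lee_fin expR_ge0|exact: (Hn i).2].
rewrite nneseriesD//; last by move=> i _ _; exact: poweR_ge0.
by apply: leeD2l; apply: epsilon_trick0; rewrite divr_ge0// ltW.
Qed.

End symbolic_entropy.

(** * Mass distribution on a product of finite sets *)

Lemma nneseries_term_le (R : realType) (u : nat -> \bar R) i :
  (forall n, 0 <= u n)%E -> (u i <= \sum_(n <oo) u n)%E.
Proof.
move=> u0; apply: le_trans (nneseries_lim_ge i.+1 (fun n _ _ => u0 n)).
by rewrite big_nat_recr//= leeDr// sume_ge0.
Qed.

(** The uniform probability on the product gives the i-th cylinder the i-th term
    of the series, so the cylinders cannot cover.  Without constructing that
    measure, x is chosen coordinate by coordinate: f n x i is the conditional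
    measure of the i-th cylinder given the first n coordinates of x, and since
    the average over the next coordinate of the sum of these is at most the
    present sum, some choice keeps the sum below 1. *)
Lemma product_not_covered (R : realType) (T : choiceType) (D : nat -> seq T)
    (t : nat -> nat) (y : nat -> nat -> T) :
  (forall n, uniq (D n)) -> (forall n, (0 < size (D n))%N) ->
  (\sum_(i <oo) (\prod_(0 <= u < t i) (size (D u))%:R^-1 : R)%:E < 1)%E ->
  exists x, (forall n, x n \in D n) /\ forall i, ~ agree (t i) (y i) x.
Proof.
move=> Duniq Dpos Ht.
pose f n (x : nat -> T) i : R := if `[< agree (minn n (t i)) (y i) x >]
  then \prod_(n <= u < t i) (size (D u))%:R^-1 else 0.
have f0 n x i : 0 <= f n x i.
  by rewrite /f; case: ifP => // _; apply: prodr_ge0 => u _; rewrite invr_ge0.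
have fE0 n x i : (0 <= (f n x i)%:E)%E by rewrite lee_fin.
pose P n x := (forall k, (k < n)%N -> x k \in D k) /\ (\sum_(i <oo) (f n x i)%:E < 1)%E.
have fagree n x x' i : agree n x x' -> f n x i = f n x' i.
  move=> xx'; rewrite /f; congr (if _ then _ else _).
  have xx'm := agree_le (geq_minl n (t i)) xx'.
  by apply/asboolP/asboolP => h; apply: agree_trans h _ => //; exact: agree_sym.
have step n x : P n x -> exists2 x', agree n x x' & P n.+1 x'.
  move=> [xD xf]; pose ext b := fun k => if (k < n)%N then x k else b.
  have extx b : agree n x (ext b) by move=> k kn; rewrite /ext kn.
  have extn b : ext b n = b by rewrite /ext ltnn.
  have avg i : \sum_(b <- D n) f n.+1 (ext b) i <= (size (D n))%:R * f n x i.
    have [tn|nt] := leqP (t i) n.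
      rewrite (eq_bigr (fun=> f n x i)) => [|b _].
        by rewrite big_const_seq count_predT iter_addr addr0 mulr_natl.
      rewrite (fagree _ _ _ _ (extx b)) /f (minn_idPr tn) (minn_idPr (leqW tn)).
      by rewrite !big_geq// leqW.
    rewrite /f (minn_idPl (ltnW nt)) (minn_idPl nt).
    rewrite [X in _ <= _ * (if _ then X else _)](big_ltn nt).
    set p := \prod_(n.+1 <= _ < _) _.
    have p0 : 0 <= p by apply: prodr_ge0 => u _; rewrite invr_ge0.
    have [yx|nyx] := asboolP (agree n (y i) x); last first.
      rewrite mulr0 big1// => b _; case: asboolP => // h; exfalso; apply: nyx.
      apply: agree_trans (agree_le (leqnSn n) h) _; exact: agree_sym.
    rewrite mulrA mulfV ?mul1r ?pnatr_eq0 -?lt0n//.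
    apply: (@le_trans _ _ (\sum_(b <- D n) if b == y i n then p else 0)).
      apply: ler_sum => b _; case: asboolP => [/(_ n (ltnSn n))|_].
        by rewrite extn => ->; rewrite eqxx.
      by case: ifP.
    rewrite -big_mkcond/= big_const_seq iter_addr addr0 count_uniq_mem//.
    by case: (_ \in _); rewrite ?mulr1n ?mulr0n.
  have [b bD bf] : exists2 b, b \in D n & (\sum_(i <oo) (f n.+1 (ext b) i)%:E < 1)%E.
    apply: contrapT => h.
    have : ((size (D n))%:R%:E <= \sum_(b <- D n) \sum_(i <oo) (f n.+1 (ext b) i)%:E :> \bar R)%E.
      apply: (@le_trans _ _ (\sum_(b <- D n) 1%:E)%E).
        by rewrite sumEFin lee_fin big_const_seq count_predT iter_addr addr0.
      rewrite big_seq [leRHS]big_seq; apply: lee_sum => b bD.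
      by rewrite leNgt; apply/negP => bf; apply: h; exists b.
    rewrite -nneseries_sum//; apply/negP; rewrite -ltNge.
    apply: (@le_lt_trans _ _ ((size (D n))%:R%:E * \sum_(i <oo) (f n x i)%:E)%E).
      rewrite -nneseriesZl//; apply: lee_nneseries => [i _ _|i _].
        exact: sume_ge0.
      by rewrite sumEFin -EFinM lee_fin.
    by rewrite -[ltRHS]mule1 lte_pmul2l// lte_fin ltr0n.
  exists (ext b) => //; split=> // k; rewrite ltnS leq_eqVlt => /orP[/eqP->|kn].
    by rewrite extn.
  by rewrite -(extx b k kn); exact: xD.
have [x0] : exists x0 : nat -> T, True.
  by have /choice[x0 _] : forall n, exists z, z \in D n;
    [move=> n; case: (D n) (Dpos n) => // z l _; exists z; exact: mem_head|exists x0].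
move=> _; have [] := @agree_extend T P x0 _ _ step.
- move=> n x x' xx' [xD xf]; split=> [k kn|]; first by rewrite -xx'// xD.
  by rewrite (eq_eseriesr (fun i _ => congr1 EFin (esym (fagree n x x' i xx')))).
- split=> //; rewrite (eq_eseriesr (g := fun i => (\prod_(0 <= u < t i) (size (D u))%:R^-1)%:E))// => i _.
  by rewrite /f min0n; case: asboolP => // -[].
move=> x xP; exists x; split=> [n|i yx]; first exact: (xP n.+1).1.
have := (xP (t i)).2; apply/negP; rewrite -leNgt.
apply: le_trans (nneseries_term_le i (fE0 (t i) x)).
by rewrite /f minnn big_geq//; case: asboolP.
Qed.

(** * Loops with small Birkhoff sums *)

(** The entries of the r-th power count the paths of length r. *)
Lemma matrix_power_path (K : nat) (A : 'M[nat]_K) r a c :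
  zero_one_mx A -> (0 < (A ^+ r) a c)%N ->
  exists p : nat -> 'I_K, [/\ p 0%N = a, p r = c &
    forall i, (i < r)%N -> A (p i) (p i.+1) = 1%N].
Proof.
move=> A01; elim: r a => [|r IH] a.
  rewrite expr0 mxE; have [->|//] := eqVneq a c.
  by exists (fun=> c).
rewrite exprS mxE => Ac.
have [b [Aab Abc]] : exists b, A a b = 1%N /\ (0 < (A ^+ r) b c)%N.
  apply: contrapT => h; move: Ac; rewrite big1// => b _.
  have [->|Aab] := A01 a b; first by rewrite mul0r.
  have [->|Abc] := posnP ((A ^+ r) b c); first by rewrite mulr0.
  by exfalso; apply: h; exists b.
have [p [p0 pr pA]] := IH b Abc.
exists (fun i => if i is j.+1 then p j else a); split=> //= -[|i] ir.
  by rewrite p0.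
exact: pA.
Qed.

Section gluing.
Context (R : realType) (K : nat) (A : 'M[nat]_K).
Hypothesis A01 : zero_one_mx A.
Local Notation X := (shift_space R K).
Local Notation shift := (@left_shift R K).

Lemma subshift_inhabited r : (1 <= r)%N -> (forall a b, (0 < (A ^+ r) a b)%N) ->
  forall a, exists x : X, subshift A x /\ x 0%N = a.
Proof.
move=> r1 Ar a; have /choice[F HF] : forall b : 'I_K, exists c, A b c = 1%N.
  move=> b; have [p [p0 pr pA]] := matrix_power_path A01 (Ar b b).
  by exists (p 1%N); rewrite -{1}p0 pA.
exists (fun n => iter n F a); split=> //.
Qed.

(** A path of length r leads from the last symbol kept of x to the first one
    of y. *)
Lemma subshift_glue r (Ar : forall a b, (0 < (A ^+ r) a b)%N) (x y : X) m :
  subshift A x -> subshift A y -> exists z : X,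
    [/\ subshift A z, agree m.+1 x z & forall i, z (m + r + i)%N = y i].
Proof.
move=> xA yA; have [p [p0 pr pA]] := matrix_power_path A01 (Ar (x m) (y 0%N)).
pose z : X := fun i => if (i <= m)%N then x i else
  if (i <= m + r)%N then p (i - m)%N else y (i - (m + r))%N.
have zx i : (i <= m)%N -> z i = x i by rewrite /z => ->.
have zp i : (i <= r)%N -> z (m + i)%N = p i.
  rewrite /z; case: i => [_|i ir]; first by rewrite addn0 leqnn p0.
  by rewrite ifF ?ifT; [congr p; lia|lia|lia].
have zy i : z (m + r + i)%N = y i.
  case: i => [|i]; first by rewrite addn0 zp.
  by rewrite /z ifF ?ifF; [congr y; lia|lia|lia].
exists z; split=> // [|i im]; last by rewrite zx.
move=> k; have [km|mk] := ltnP k m; first by rewrite !zx// ltnW.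
rewrite -(subnKC mk) -addnS; have [kr|rk] := ltnP (k - m) r.
  by rewrite !zp ?pA// ltnW.
have -> : (m + (k - m) = m + r + (k - m - r))%N by lia.
have -> : (m + (k - m).+1 = m + r + (k - m - r).+1)%N by lia.
by rewrite !zy.
Qed.

Section loops.
Context (g : X -> R) (M : R) (a0 : 'I_K).
Hypothesis A_aper : aperiodic_irreducible A.
Hypothesis gM : forall x, subshift A x -> `|g x| <= M.
Hypothesis g_unif : forall e : R, 0 < e -> exists N, forall x y : X,
  subshift A x -> subshift A y -> agree N x y -> `|g x - g y| <= e.

Definition almost_null_words (e : R) n : {set {ffun 'I_n -> 'I_K}} :=
  [set w | `[< exists x : X, [/\ subshift A x, prefix n x = w &
     `|birkhoff_sum g n x| <= e * n%:R] >]].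

(** A loop of length L at a0 is represented by a point b of the subshift with
    b 0 = b L = a0, of which only the first L coordinates matter; admissibility of
    concatenations is then inherited from the points.  The last clause bounds
    the Birkhoff sum for every point starting with the loop. *)
Definition loop_family (e h : R) (L : nat) (D : seq X) : Prop :=
  [/\ (0 < L)%N, expR (h * L%:R) <= (size D)%:R,
      uniq D /\ {in D &, forall b b', agree L b b' -> b = b'},
      {in D, forall b, [/\ subshift A b, b 0%N = a0 & b L = a0]} &
      {in D, forall b (x : X), subshift A x -> agree L b x ->
        `|birkhoff_sum g L x| <= e * L%:R}].

(** The word made of the first n symbols of x is preceded and followed by paths
    joining it to a0. *)
Lemma loop_through r n (x : X) : (1 <= r)%N -> (0 < n)%N ->
  (forall a b, (0 < (A ^+ r) a b)%N) -> subshift A x ->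
  exists b : X, [/\ subshift A b, b 0%N = a0, b (r + n.-1 + r)%N = a0 &
    agree n (iter r shift b) x].
Proof.
move=> r1 n1 Ar xA; have [q [qA q0]] := subshift_inhabited r1 Ar a0.
have [z [zA qz zx]] := subshift_glue Ar 0 qA xA.
have [b [bA zb bq]] := subshift_glue Ar (r + n.-1) zA qA.
exists b; split=> //.
- by rewrite -zb// -qz.
- by rewrite -[(_ + _)%N]addn0 bq.
- move=> i ni; have rin : (r + i < (r + n.-1).+1)%N by clear -ni; lia.
  by rewrite iter_shiftE -zb// -zx add0n.
Qed.

(** For n large, the 2 r - 1 symbols added to a word of length n change neither
    the exponential growth rate by more than h - h' nor the mean of g by more than
    a fraction of e; likewise for the variation of the Birkhoff sum on the
    cylinder. *)
Lemma loop_families (h h' : R) : 0 <= h' -> h' < h ->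
  (forall (e : R) N, 0 < e -> exists2 n, (N <= n)%N &
     expR (h * n%:R) < #|almost_null_words e n|%:R) ->
  forall e : R, 0 < e -> exists L D, loop_family e h' L D.
Proof.
move=> h'0 h'h many e e0.
have [r [r1 Ar]] := A_aper.
have [q [qA q0]] := subshift_inhabited r1 Ar a0.
have M0 : 0 <= M := le_trans (normr_ge0 _) (gM qA).
have e40 : 0 < e / 4 by lra.
have [N1 HN1] := birkhoff_sum_variation gM g_unif e40.
have hh'0 : 0 < h - h' by rewrite subr_gt0.
have [N2 HN2] := eventually_lt_linear (2 * h' * r%:R) hh'0.
have [N3 HN3] := eventually_lt_linear (4 * M * r%:R) e0.
have [n Nn many_n] := many (e / 4) (N1 + N2 + N3).+1 e40.
have [Nn1 Nn2 Nn3 n1] : [/\ (N1 <= n)%N, (N2 <= n)%N, (N3 <= n)%N & (0 < n)%N].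
  by clear -Nn; split; lia.
have {HN1} HN1 x y := HN1 n x y Nn1.
have {HN2} n2 := HN2 n Nn2; have {HN3} n3 := HN3 n Nn3.
have [L EL] : exists L, L = (r + n.-1 + r)%N by eexists.
have [nL LE ELn rnL] : [/\ (n <= L)%N, (L <= n + 2 * r)%N, L = (r + (n + r.-1))%N &
    (r + n <= L)%N] by clear -EL r1 n1; split; lia.
rewrite -(ler_nat R) in nL; rewrite -(ler_nat R) natrD natrM in LE.
have /choice[b Hb] : forall w : {ffun 'I_n -> 'I_K}, exists b : X,
    w \in almost_null_words (e / 4) n ->
    [/\ subshift A b, b 0%N = a0, b L = a0, prefix n (iter r shift b) = w &
      exists x : X, [/\ subshift A x, prefix n x = w & `|birkhoff_sum g n x| <= e / 4 * n%:R]].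
  move=> w; have [|_] := boolP (w \in _); last by exists q.
  rewrite inE => /asboolP[x [xA xw xg]].
  have [b [bA b0 bL bx]] := loop_through r1 n1 Ar xA.
  exists b => _; split=> //; [by rewrite EL|by rewrite -xw; apply/prefixP|by exists x].
pose D := [seq b w | w <- enum (almost_null_words (e / 4) n)].
have DP z : z \in D -> exists2 w, w \in almost_null_words (e / 4) n & z = b w.
  by move=> /mapP[w]; rewrite mem_enum => wW ->; exists w.
have binj w w' : w \in almost_null_words (e / 4) n -> w' \in almost_null_words (e / 4) n ->
    agree L (b w) (b w') -> w = w'.
  move=> /Hb[_ _ _ bw _] /Hb[_ _ _ bw' _] ww'.
  by rewrite -bw -bw'; apply/prefixP/agree_shift; apply: agree_le ww'.
exists L, D; split.
- by rewrite EL addn_gt0 r1 orbT.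
- rewrite size_map -cardE; apply: le_trans (ltW many_n); rewrite ler_expR.
  have : h' * L%:R <= h' * (n%:R + 2 * r%:R) by rewrite ler_wpM2l.
  by move: n2; lra.
- split.
    rewrite map_inj_in_uniq ?enum_uniq// => w w'; rewrite !mem_enum => wW w'W ww'.
    by apply: binj => //; rewrite ww'.
  by move=> _ _ /DP[w wW ->] /DP[w' w'W ->] /binj -> .
- by move=> _ /DP[w /Hb[? ? ? _ _] ->].
- move=> _ /DP[w /Hb[bA _ _ bw [y [yA yw yg]]] ->] x xA bx.
  have rxA := subshift_shift r xA.
  have xy : agree n (iter r shift x) y.
    apply: agree_trans (_ : agree n (iter r shift (b w)) y); last first.
      by apply/prefixP; rewrite bw yw.
    by apply/agree_shift/agree_sym; apply: agree_le bx.
  have := HN1 _ _ rxA yA xy.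
  have := birkhoff_sum_bound gM r xA.
  have := birkhoff_sum_bound gM r.-1 (subshift_shift n rxA).
  have : M * r.-1%:R <= M * r%:R by rewrite ler_wpM2l// ler_nat leq_pred.
  have -> : birkhoff_sum g L x = birkhoff_sum g r x + (birkhoff_sum g n (iter r shift x) +
      birkhoff_sum g r.-1 (iter n shift (iter r shift x))).
    by rewrite ELn !birkhoff_sumD.
  have : e * n%:R <= e * L%:R by rewrite ler_pM2l.
  move: yg n3.
  move: (birkhoff_sum g r x) (birkhoff_sum g n y) (birkhoff_sum g n _) (birkhoff_sum g r.-1 _).
  move=> a1 a2 a3 a4; rewrite !ler_norml.
  move=> /andP[? ?] ? ? ? /andP[? ?] /andP[? ?] /andP[? ?].
  by apply/andP; split; lra.
Qed.

End loops.
End gluing.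

(** * Slow concatenation of loops *)

(** The index j is raised exactly when the total length already reached makes
    this compatible with the bound.  As the total length grows without bound,
    every index is eventually passed. *)
Lemma slow_schedule (L : nat -> nat) : (forall j, (0 < L j)%N) ->
  exists j : nat -> nat,
    (forall t, (j t * L (j t) <= \sum_(0 <= u < t) L (j u))%N) /\
    (forall J, exists T, forall t, (T <= t)%N -> (J <= j t)%N).
Proof.
move=> L0.
(* The second component of the state is the total length so far. *)
pose step (jl : nat * nat) : nat * nat := let l := (jl.2 + L jl.1)%N in
  (if (jl.1.+1 * L jl.1.+1 <= l)%N then jl.1.+1 else jl.1, l).
pose st t := iter t step (0%N, 0%N).
pose j t := (st t).1.
have stl t : (st t).2 = (\sum_(0 <= u < t) L (j u))%N.
  elim: t => [|t IH]; first by rewrite big_geq.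
  by rewrite big_nat_recr//= -IH.
have jS t : j t.+1 = if ((j t).+1 * L (j t).+1 <= \sum_(0 <= u < t.+1) L (j u))%N
    then (j t).+1 else j t.
  by rewrite big_nat_recr//= -stl.
have jmono : {homo j : t u / (t <= u)%N}.
  apply: homo_leq => // [|t]; first exact: leq_trans.
  by rewrite jS; case: ifP.
exists j; split=> [t|].
  elim: t => [//|t IH]; rewrite jS; case: ifP => // _.
  by apply: leq_trans IH _; rewrite big_nat_recr//= leq_addr.
elim=> [|J [T HT]]; first by exists 0%N.
have [t Tt] : exists2 t, (T <= t)%N & (J < j t)%N.
  apply: contrapT => h.
  have jJ t : (T <= t)%N -> j t = J.
    move=> Tt; apply/eqP; rewrite eqn_leq HT// andbT leqNgt.
    by apply/negP => Jj; apply: h; exists t.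
  pose t := (T + J.+1 * L J.+1)%N.
  have Tt : (T <= t)%N by apply: leq_addr.
  have := jJ t.+1 (leqW Tt); rewrite jS jJ// ifT; first by lia.
  apply: (@leq_trans (\sum_(0 <= u < t.+1) 1)%N).
    by rewrite sum_nat_const_nat subn0 muln1 /t; lia.
  by apply: leq_sum => u _; exact: L0.
by move=> Jt; exists t => u /jmono; exact: leq_trans.
Qed.

Section concatenation.
Context (len : nat -> nat).
Hypothesis len_gt0 : forall t, (0 < len t)%N.

Definition start t := (\sum_(0 <= u < t) len u)%N.

Lemma startS t : start t.+1 = (start t + len t)%N.
Proof. by rewrite /start big_nat_recr. Qed.

Lemma start_le : {homo start : t u / (t <= u)%N}.
Proof.
apply: homo_leq => // [|t]; first exact: leq_trans.
by rewrite startS leq_addr.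
Qed.

Lemma block_decomposition n : exists t i, n = (start t + i)%N /\ (i < len t)%N.
Proof.
elim: n => [|n [t [i [-> it]]]]; first by exists 0%N, 0%N; rewrite /start big_geq.
have [it'|] := ltnP i.+1 (len t); first by exists t, i.+1; rewrite addnS.
by exists t.+1, 0%N; rewrite startS; split=> //; lia.
Qed.

Lemma block_index_unique t i t' i' : (start t + i = start t' + i')%N ->
  (i < len t)%N -> (i' < len t')%N -> t = t'.
Proof.
have half a b c d : (start a + c = start b + d)%N -> (c < len a)%N -> (b <= a)%N.
  move=> e ca; rewrite leqNgt; apply/negP => ab.
  by have := start_le ab; rewrite startS; lia.
move=> e it it'; apply/eqP; rewrite eqn_leq.
by rewrite (half _ _ _ _ e it) (half _ _ _ _ (esym e) it').
Qed.

Lemma concatenation (T : Type) (y : nat -> nat -> T) :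
  exists x : nat -> T, forall t i, (i < len t)%N -> x (start t + i)%N = y t i.
Proof.
have /choice[t /choice[i Hti]] := block_decomposition.
exists (fun n => y (t n) (i n)) => u k ku.
have [E iu] := Hti (start u + k)%N.
by have tu := block_index_unique E ku iu; move: E; rewrite -tu => /addnI <-.
Qed.

End concatenation.

Lemma sublinearP (R : realType) (u : nat -> R) :
  (forall e : R, 0 < e -> exists C, forall n, u n <= e * n%:R + C) ->
  forall e : R, 0 < e -> exists N, forall n, (N <= n)%N -> u n <= e * n%:R.
Proof.
move=> h e e0; have e20 : 0 < e / 2 by lra.
have [C HC] := h _ e20; have [N HN] := eventually_lt_linear C e20.
by exists N => n /HN; have := HC n; lra.
Qed.

Section moran.
Context (R : realType) (K : nat) (A : 'M[nat]_K).
Local Notation X := (shift_space R K).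
Local Notation shift := (@left_shift R K).
Context (g : X -> R) (M : R) (a0 : 'I_K) (h : R).
Hypothesis gM : forall x, subshift A x -> `|g x| <= M.
Hypothesis M_ge0 : 0 <= M.
Hypothesis loops : forall e : R, 0 < e -> exists L D, loop_family A g a0 e h L D.

(** Loops of precision 1 / (j + 1), with j following a slow schedule. *)
Lemma loop_schedule : exists (len : nat -> nat) (D : nat -> seq X),
  [/\ forall t, exists e, loop_family A g a0 e h (len t) (D t),
    (forall e : R, 0 < e -> exists C, forall t, (len t)%:R <= e * (start len t)%:R + C) &
    (forall e : R, 0 < e -> exists T, forall t, (T <= t)%N ->
      exists2 e', e' <= e & loop_family A g a0 e' h (len t) (D t))].
Proof.
have /choice[L /choice[D LD]] : forall j, exists L D, loop_family A g a0 j.+1%:R^-1 h L D.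
  by move=> j; apply: loops; rewrite invr_gt0.
have L0 j : (0 < L j)%N by case: (LD j).
have [j [jL jinf]] := slow_schedule L0.
have small (e : R) : 0 < e -> exists T, forall t, (T <= t)%N -> 1 < e * (j t)%:R.
  move=> e0; have [J HJ] := eventually_lt_linear 1 e0.
  by have [T HT] := jinf J; exists T => t /HT /HJ; rewrite mulrC.
exists (L \o j), (D \o j); split=> [t|e e0|e e0].
- by exists (j t).+1%:R^-1; exact: LD.
- have [T HT] := small e e0; exists (start (L \o j) T)%:R => t.
  have [Tt|tT] := leqP T t.
    have : ((j t * L (j t))%:R : R) <= (start (L \o j) t)%:R by rewrite ler_nat; exact: jL.
    rewrite natrM => jlt; have := HT t Tt.
    have : (0 : R) <= (start (L \o j) T)%:R by [].
    have : (0 : R) <= (L (j t))%:R by [].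
    rewrite /=; move: jlt; move: ((j t)%:R : R) ((L (j t))%:R : R) ((start _ t)%:R : R) ((start _ T)%:R : R).
    move=> a b c d; nra.
  apply: (@le_trans _ _ (start (L \o j) t.+1)%:R).
    by rewrite ler_nat startS leq_addl.
  apply: (@le_trans _ _ (start (L \o j) T)%:R); first by rewrite ler_nat start_le.
  by rewrite lerDr mulr_ge0// ltW.
- have [T HT] := small e e0; exists T => t /HT jt.
  exists (j t).+1%:R^-1; last exact: LD.
  by rewrite -div1r ler_pdivrMr// -natr1; lra.
Qed.

Definition null_average_points : set X := [set x | subshift A x /\
  forall e : R, 0 < e -> exists N, forall n, (N <= n)%N ->
    `|birkhoff_sum g n x| <= e * n%:R].

(** Every concatenation of loops chosen in the successive families D t is a point
    of Y: its Birkhoff sums at the times start t are small because the precisions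
    tend to 0, and between these times because the next length is negligible.
    The first t loops can be chosen in at least exp (h start t) ways, and a set of
    points agreeing on n coordinates with start t <= n < start t.+1 determines
    these loops.  So if a cover had total weight below a fixed constant, the
    concatenations it contains would lie in cylinders of total mass less than 1 in
    the product of the D t, and [product_not_covered] yields a concatenation that they miss. *)
Lemma htop_ge_loops (Y : set X) :
  null_average_points `<=` Y -> (h%:E <= htop Y)%E.
Proof.
move=> NY.
have [len [D [DL slow small]]] := loop_schedule.
have len0 t : (0 < len t)%N by have [e []] := DL t.
have /choice[F HF] := concatenation len0 (T := 'I_K).
have Fadm (y : nat -> X) : (forall t, y t \in D t) -> subshift A (F y : X).
  move=> yD k; have [t [i [-> it]]] := block_decomposition len0 k.
  have [e [_ _ _ loop _]] := DL t; have [yA _ yL] := loop _ (yD t).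
  have [it'|ti] := ltnP i.+1 (len t); first by rewrite -addnS !HF// yA.
  have -> : (start len t + i).+1 = (start len t.+1 + 0)%N by rewrite startS; lia.
  have [e' [_ _ _ loop' _]] := DL t.+1; have [_ y0 _] := loop' _ (yD t.+1).
  rewrite !HF// y0 -yL (_ : len t = i.+1); first exact: yA.
  by apply/eqP; rewrite eqn_leq ti it.
have Fblock (y : nat -> X) t : agree (len t) (y t) (iter (start len t) shift (F y : X)).
  by move=> i it; rewrite iter_shiftE HF.
have Fnull (y : nat -> X) : (forall t, y t \in D t) ->
    forall e : R, 0 < e -> exists N, forall n, (N <= n)%N ->
    `|birkhoff_sum g n (F y : X)| <= e * n%:R.
  move=> yD; have xA := Fadm y yD; set x : X := F y in xA *.
  apply: sublinearP => e e0; have e20 : 0 < e / 2 by lra.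
  have [T HT] := small _ e20.
  have starts t : `|birkhoff_sum g (start len t) x| <=
      e / 2 * (start len t)%:R + M * (start len T)%:R.
    elim: t => [|t IH].
      by rewrite {1 2}/start big_geq// /birkhoff_sum big_geq// normr0 mulr0 add0r mulr_ge0.
    have [tT|Tt] := leqP t.+1 T.
      apply: le_trans (birkhoff_sum_bound gM _ xA) _.
      have : M * (start len t.+1)%:R <= M * (start len T)%:R.
        by rewrite ler_wpM2l// ler_nat start_le.
      have : 0 <= e / 2 * (start len t.+1)%:R by rewrite mulr_ge0// ltW.
      by lra.
    rewrite startS birkhoff_sumD; apply: le_trans (ler_normD _ _) _.
    have [e' e'e [_ _ _ _ blk]] := HT t Tt.
    have := blk _ (yD t) _ (subshift_shift (start len t) xA) (Fblock y t).
    have : e' * (len t)%:R <= e / 2 * (len t)%:R by rewrite ler_wpM2r.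
    by rewrite natrD mulrDr; lra.
  have e2M : 0 < e / 2 / (M + 1) by rewrite divr_gt0// ltr_wpDl.
  have [C HC] := slow _ e2M.
  exists (M * (start len T)%:R + M * C) => n.
  have [t [i [-> it]]] := block_decomposition len0 n.
  rewrite birkhoff_sumD; apply: le_trans (ler_normD _ _) _.
  have := starts t.
  have := birkhoff_sum_bound gM i (subshift_shift (start len t) xA).
  have : M * i%:R <= M * (len t)%:R by rewrite ler_wpM2l// ler_nat ltnW.
  have : M * (len t)%:R <= M * (e / 2 / (M + 1) * (start len t)%:R + C) by rewrite ler_wpM2l.
  have : M * (e / 2 / (M + 1) * (start len t)%:R) <= e / 2 * (start len t)%:R.
    rewrite mulrA ler_wpM2r// mulrCA ger_pMr//.
    by rewrite ler_pdivrMr ?ltr_wpDl// mul1r lerDl.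
  have : 0 <= e * i%:R by rewrite mulr_ge0// ltW.
  by rewrite natrD !mulrDr; lra.
apply: htop_ge_mass => lambda l0 lh.
have kappa0 : 0 < (h - lambda) / lambda by rewrite divr_gt0// subr_gt0.
have [C HC] := slow _ kappa0.
(* The mass exp (- h start t) is at most a constant times exp (- lambda n). *)
have weight t n : (n <= start len t.+1)%N ->
    - (h * (start len t)%:R) <= lambda * C - lambda * n%:R.
  rewrite -(ler_nat R) startS natrD => nt.
  have : lambda * (len t)%:R <= lambda * ((h - lambda) / lambda * (start len t)%:R + C).
    by rewrite ler_pM2l.
  rewrite mulrDr mulrA [lambda * (_ / _)]mulrC divfK ?gt_eqF//.
  have : lambda * n%:R <= lambda * ((start len t)%:R + (len t)%:R) by rewrite ler_pM2l.
  lra.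
exists (expR (- (lambda * C))); first exact: expR_gt0.
move=> n E YE En; rewrite leNgt; apply/negP => small_sum.
have /choice[t /choice[i Hti]] := fun k => block_decomposition len0 (n k).
(* The cylinder attached to E k is that of any concatenation lying in E k; sets
   that contain none may be given an arbitrary cylinder. *)
have /choice[y Hy] : forall k, exists y : nat -> X, forall y' : nat -> X,
    (forall t, y' t \in D t) -> E k (F y' : X) ->
    (forall t, y t \in D t) /\ E k (F y : X).
  move=> k; have [[y' y'D]|ny] := pselect (exists2 y' : nat -> X,
    (forall t, y' t \in D t) & E k (F y' : X)); first by exists y'.
  by exists (fun _ _ => a0) => y' y'D Ey'; exfalso; apply: ny; exists y'.
have Duniq u : uniq (D u) by have [e [_ _ []]] := DL u.
have Dsize u : expR (h * (len u)%:R) <= (size (D u))%:R by have [e []] := DL u.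
have Dpos u : (0 < size (D u))%N.
  by rewrite -(ltr_nat R); apply: lt_le_trans (Dsize u); exact: expR_gt0.
have [|y' [y'D ny']] := @product_not_covered R X D t y Duniq Dpos.
  apply: (@le_lt_trans _ _ ((expR (lambda * C))%:E *
      \sum_(k <oo) (expR (- (lambda * (n k)%:R)))%:E)%E).
    rewrite -nneseriesZl => [|k _]; last by rewrite lee_fin expR_ge0.
    apply: lee_nneseries => [k _ _|k _].
      by rewrite lee_fin prodr_ge0// => u _; rewrite invr_ge0.
    rewrite -EFinM lee_fin -expRD.
    apply: (@le_trans _ _ (expR (- (h * (start len (t k))%:R)))); last first.
      by rewrite ler_expR; apply: weight; have [-> ?] := Hti k; rewrite startS; lia.
    elim: (t k) => [|u IH].
      by rewrite /start !big_geq// mulr0 oppr0 expR0.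
    rewrite startS natrD mulrDr opprD expRD big_nat_recr//=.
    apply: ler_pM => //; first by rewrite prodr_ge0// => v _; rewrite invr_ge0.
    by rewrite expRN lef_pV2 ?posrE ?expR_gt0 ?ltr0n.
  have : ((expR (lambda * C))%:E * (expR (- (lambda * C)))%:E = 1)%E.
    by rewrite -EFinM expRxMexpNx_1.
  by move=> <-; rewrite lte_pmul2l// lte_fin expR_gt0.
have [k _ Ek] := YE _ (NY _ (conj (Fadm y' y'D) (Fnull y' y'D))).
have [yD Eky] := Hy k y' y'D Ek.
apply: (ny' k) => u ut.
have [e [_ _ [_ Dinj] _ _]] := DL u.
apply: Dinj; [exact: yD|exact: y'D|].
move=> v vu; rewrite -!(HF _ u v vu); apply: En Eky Ek _ _.
have [-> _] := Hti k.
by have := start_le len ut; rewrite startS; lia.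
Qed.

End moran.

(** * Equality of the entropies *)

Section sandwich.
Context (R : realType) (K : nat) (A : 'M[nat]_K).
Local Notation X := (shift_space R K).
Hypothesis K_gt0 : (0 < K)%N.
Hypothesis A01 : zero_one_mx A.
Hypothesis A_aper : aperiodic_irreducible A.
Context (g : X -> R) (M : R).
Hypothesis gM : forall x, subshift A x -> `|g x| <= M.
Hypothesis g_unif : forall e : R, 0 < e -> exists N, forall x y : X,
  subshift A x -> subshift A y -> agree N x y -> `|g x - g y| <= e.

Definition null_cluster_points : set X := [set x | subshift A x /\
  forall (e : R) N, 0 < e ->
    exists2 n, (N <= n)%N & `|birkhoff_sum g n x| <= e * n%:R].

(** An h strictly between the two entropies is refuted by counting the almost null
    words: a growth rate at most h bounds the entropy of Z from above, a rate above
    h bounds the entropy of Y from below. *)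
Lemma htop_sandwich (Y Z : set X) : null_average_points A g `<=` Y ->
  Z `<=` null_cluster_points -> (htop Z <= htop Y)%E.
Proof.
move=> NY ZC; rewrite leNgt; apply/negP => YZ.
have [h' [h [h'0 h'h Yh' hZ]]] : exists h' h : R, [/\ 0 <= h', h' < h,
    (htop Y < h'%:E)%E & (h%:E < htop Z)%E].
  have := bowen_entropy_ge0 R (@left_shift R K) Y; rewrite -/(htop Y).
  move: YZ; case: (htop Y) (htop Z) => [a| |] [b| |]//=.
    rewrite lte_fin lee_fin => ab a0; exists (a + (b - a) / 3), (a + (b - a) * 2 / 3).
    by rewrite !lte_fin; split; lra.
  move=> _; rewrite lee_fin => a0; exists (a + 1), (a + 2).
  by rewrite ltry lte_fin; split=> //; lra.
have M0 : 0 <= M.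
  have [r [r1 Ar]] := A_aper.
  have [x [xA _]] := subshift_inhabited R A01 r1 Ar (Ordinal K_gt0).
  exact: le_trans (gM xA).
have [[e e0 [N HN]]|many] := pselect (exists2 e : R, 0 < e & exists N, forall n,
    (N <= n)%N -> #|almost_null_words A g e n|%:R <= expR (h * n%:R)).
  move: hZ; apply/negP; rewrite -leNgt.
  apply: (htop_le_prefix_count K_gt0 (W := almost_null_words A g e) _ _ HN).
    exact: le_trans h'0 (ltW h'h).
  move=> x N' /ZC[xA xC]; have [n N'n xn] := xC e N' e0.
  by exists n => //; rewrite inE; apply/asboolP; exists x.
move: Yh'; apply/negP; rewrite -leNgt.
apply: (htop_ge_loops (a0 := Ordinal K_gt0) gM M0) => // e e0.
apply: (loop_families A01 (Ordinal K_gt0) A_aper gM g_unif h'0 h'h) => // e' N e'0.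
apply: contrapT => few; apply: many; exists e' => //; exists N => n Nn.
by rewrite leNgt; apply/negP => lt; apply: few; exists n.
Qed.

End sandwich.

Theorem theorem1p3 (R : realType) (K : nat) (A : 'M[nat]_K)
    (phi : shift_space R K -> R) (s : nat -> R)
    (hK : (0 < K)%N)
    (hA01 : zero_one_mx A)
    (hA : aperiodic_irreducible A)
    (hphi : {within subshift A, continuous phi})
    (hs_pos : forall n, 0 < s n)
    (hs_dec : forall m n, (m <= n)%N -> s n <= s m)
    (hs_lim : s n @[n --> \oo] --> (0 : R))
    (hS_lim : (\sum_(0 <= k < n) s k) @[n --> \oo] --> +oo)
    (alpha : R) :
  htop (birkhoff_level A phi alpha) = htop (weighted_birkhoff_level A phi s alpha).
Proof.
pose g (x : shift_space R K) := phi x - alpha.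
have g_unif (e : R) : 0 < e -> exists N, forall x y : shift_space R K,
    subshift A x -> subshift A y -> agree N x y -> `|g x - g y| <= e.
  move=> e0; have [N HN] := uniform_continuity hphi e0.
  exists N => x y xA yA xy; rewrite /g (_ : _ - _ = phi x - phi y); last by ring.
  exact: HN.
have [M gM] : exists M, forall x : shift_space R K, subshift A x -> `|g x| <= M.
  have [M HM] := continuous_bounded hphi; exists (M + `|alpha|) => x xA.
  by apply: le_trans (ler_normB _ _) _; rewrite lerD2r HM.
have null_of_level : birkhoff_level A phi alpha `<=` null_average_points A g.
  move=> x [xA /(cvg_ratioP _ _ (fun n => ltr0Sn R n))xl]; split=> // e /xl[N HN].
  by exists N => n /HN; rewrite birkhoff_sumBr.
have level_of_null : null_average_points A g `<=` birkhoff_level A phi alpha.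
  move=> x [xA xl]; split=> //; apply/(cvg_ratioP _ _ (fun n => ltr0Sn R n)) => e /xl[N HN].
  by exists N => n /HN; rewrite birkhoff_sumBr.
have S_gt0 n : 0 < \sum_(0 <= k < n.+1) s k.
  by rewrite big_nat_recr//= ltr_wpDl// sumr_ge0// => k _; exact: ltW.
have weighted_sumE x n :
    \sum_(0 <= k < n) s k * phi (iter k (@left_shift R K) x) -
      alpha * \sum_(0 <= k < n) s k =
    \sum_(0 <= k < n) s k * g (iter k (@left_shift R K) x).
  by rewrite mulr_sumr -sumrB; apply: eq_bigr => k _; rewrite /g; ring.
have level_sub_weighted : birkhoff_level A phi alpha `<=`
    weighted_birkhoff_level A phi s alpha.
  move=> x /null_of_level[xA xl]; split=> //; apply/(cvg_ratioP _ _ S_gt0) => e e0.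
  have [N HN] := cesaro_null_weighted_null hs_pos hs_dec hS_lim xl e0.
  by exists N => n /HN; rewrite weighted_sumE.
have weighted_sub_cluster : weighted_birkhoff_level A phi s alpha `<=`
    null_cluster_points A g.
  move=> x [xA /(cvg_ratioP _ _ S_gt0) xl]; split=> // e N e0.
  apply: (weighted_null_cluster hs_pos hs_dec hS_lim (M := M)) => //.
    by move=> k; exact/gM/subshift_shift.
  by move=> e' /xl[N' HN']; exists N' => n /HN'; rewrite weighted_sumE.
have sandwich := htop_sandwich hK hA01 hA gM g_unif.
apply/eqP; rewrite eq_le; apply/andP; split; apply: sandwich => //.
- exact: subset_trans level_of_null level_sub_weighted.
- exact: subset_trans level_sub_weighted weighted_sub_cluster.
Qed.
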